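(* Let $n>2$ and let $\mathfrak n\subseteq\mathfrak{gl}(n|n)$ be the nilpotent subalgebra described in the context. Then $$\dim\operatorname{H}^2(\mathfrak n,\mathbb C)=8n^2-20n+16.$$
   Context: All spaces are over $\mathbb C$. Rows and columns of matrices in $\mathfrak{gl}(n|n)$ are indexed by $\bar1,\dots,\bar n$ (even) and $1,\dots,n$ (odd); $E_{ab}$ are the elementary matrices, with supercommutator bracket $[E_{ab},E_{cd}]=\delta_{bc}E_{ad}-(-1)^{|E_{ab}||E_{cd}|}\delta_{da}E_{cb}$. The subalgebra $\mathfrak n$ is spanned by $E_{\bar i,\bar j}$, $E_{i,j}$, $E_{\bar i,j}$ and $E_{i,\bar j}$ for all $1\le i<j\le n$. $\operatorname{H}^\bullet(\mathfrak n,\mathbb C)$ is the Lie superalgebra cohomology with trivial (even, one-dimensional) coefficients, i.e. the cohomology of the complex $C^p=\operatorname{Hom}(\Lambda_s^p(\mathfrak n),\mathbb C)$ with $\Lambda_s^p(\mathfrak n)=\bigoplus_{i+j=p}\Lambda^i(\mathfrak n_{\bar0})\otimes S^j(\mathfrak n_{\bar1})$ and differential $$df(\omega_0\wedge\cdots\wedge\omega_p)=\sum_{i<j}(-1)^{\sigma_{i,j}}f([\omega_i,\omega_j]\wedge\omega_0\wedge\cdots\widehat{\omega_i}\cdots\widehat{\omega_j}\cdots\wedge\omega_p),$$ $\sigma_{i,j}=i+j+|\omega_i||\omega_j|+|\omega_i|(|\omega_0|+\cdots+|\omega_{i-1}|)+|\omega_j|(|\omega_0|+\cdots+|\omega_{j-1}|)$.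 *)

(* Defs.v *)
From HB Require Import structures.
From mathcomp Require Import all_boot all_order all_algebra.
From mathcomp Require Import complex.
From mathcomp Require Import reals.
From mathcomp Require Import ring.

Set Implicit Arguments.
Unset Strict Implicit.
Unset Printing Implicit Defensive.

Import GRing.Theory.
Local Open Scope ring_scope.

(* A finite-dimensional Lie superalgebra over F, given by a homogeneous basis
   (e_x), the parity of each e_x, and the structure constants
   [e_x, e_y] = \sum_z lsBr x y z *: e_z.  Over a field of characteristic
   not 2 and 3, which is the only case used, the axioms below are the usual
   ones. *)
Record lieSuperalgebra (F : fieldType) := LieSuperalgebra {
  lsBasis : finType;
  lsPar : lsBasis -> bool;
  lsBr : lsBasis -> lsBasis -> lsBasis -> F;
  lsBr_par : forall x y z, lsBr x y z != 0 -> lsPar z = lsPar x (+) lsPar y;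
  lsBr_skew : forall x y z,
    lsBr y x z = - (-1) ^+ (lsPar x * lsPar y) * lsBr x y z;
  (* [x, [y, z]] = [[x, y], z] + (-1)^(|x||y|) [y, [x, z]] *)
  lsBr_jacobi : forall x y z w,
    \sum_u lsBr y z u * lsBr x u w =
    \sum_u lsBr x y u * lsBr u z w +
    (-1) ^+ (lsPar x * lsPar y) * \sum_u lsBr x z u * lsBr y u w }.

Section Cohomology.
Variables (F : fieldType) (L : lieSuperalgebra F).
Local Notation I := (lsBasis L).
Local Notation par := (@lsPar F L).

(* A p-linear form on L is recorded by its values on the p-tuples of basis
   vectors. *)
Definition mform (p : nat) := {ffun {ffun 'I_p -> I} -> F^o}.

Definition swap p (i j : 'I_p) (t : {ffun 'I_p -> I}) : {ffun 'I_p -> I} :=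
  [ffun l => if l == i then t j else if l == j then t i else t l].

(* The linear conditions cutting out Hom(Lambda_s^p L, F) among the p-linear
   forms: f(.., b, a, ..) = - (-1)^(|a||b|) f(.., a, b, ..). *)
Definition altdef p (f : mform p)
    : {ffun 'I_p * 'I_p * {ffun 'I_p -> I} -> F^o} :=
  [ffun q : 'I_p * 'I_p * {ffun 'I_p -> I} =>
             if val q.1.2 == (val q.1.1).+1
             then f (swap q.1.1 q.1.2 q.2)
                  + (-1) ^+ (par (q.2 q.1.1) * par (q.2 q.1.2)) * f q.2
             else 0].

Definition cochains p : {vspace mform p} := lker (linfun (@altdef p)).

(* The p-tuple e_k, t_0, .., t_p with t_i and t_j omitted (for i < j). *)
Definition contract p (t : {ffun 'I_p.+1 -> I}) (i j : 'I_p.+1) (k : I)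
    : {ffun 'I_p -> I} :=
  [ffun l : 'I_p => if val l == 0%N then k
                    else t (inord (bump j (bump i l.-1)))].

Definition sigma p (t : {ffun 'I_p.+1 -> I}) (i j : 'I_p.+1) : nat :=
  (i + j + par (t i) * par (t j)
   + par (t i) * \sum_(l < p.+1 | l < i) par (t l)
   + par (t j) * \sum_(l < p.+1 | l < j) par (t l))%N.

Definition dform p (f : mform p) : mform p.+1 :=
  [ffun t : {ffun 'I_p.+1 -> I} =>
     \sum_(i < p.+1) \sum_(j < p.+1 | (i < j)%N)
       (-1) ^+ sigma t i j *
       \sum_k lsBr (t i) (t j) k * f (contract t i j k)].

Definition cocycles p : {vspace mform p} :=
  (cochains p :&: lker (linfun (@dform p)))%VS.

Definition coboundaries p : {vspace mform p} :=
  match p with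
  | 0 => 0%VS
  | q.+1 => (linfun (@dform q) @: cochains q)%VS
  end.

Definition cohomology_dim p : nat := (\dim (cocycles p) - \dim (coboundaries p))%N.

(* linfun and lker only have their intended meaning for maps that are
   linear. *)
Lemma altdef_is_linear p : linear (@altdef p).
Proof.
move=> a f g; apply/ffunP=> q; rewrite !ffunE.
case: ifP => _; last by rewrite scaler0 addr0.
rewrite /GRing.scale /= !mulrDr mulrCA -!addrA; congr (_ + _).
by rewrite addrCA.
Qed.

HB.instance Definition _ p :=
  GRing.isLinear.Build F (mform p) _ _ (@altdef p) (@altdef_is_linear p).

Lemma dform_is_linear p : linear (@dform p).
Proof.
move=> a f g; apply/ffunP=> t; rewrite !ffunE.
rewrite /GRing.scale /= mulr_sumr -big_split; apply: eq_bigr => i _ /=.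
rewrite mulr_sumr -big_split; apply: eq_bigr => j _ /=.
rewrite mulrCA -mulrDr; congr (_ * _); rewrite mulr_sumr.
rewrite -[RHS]big_split; apply: eq_bigr => k _ /=.
by rewrite !ffunE mulrDr [in LHS]mulrCA.
Qed.

HB.instance Definition _ p :=
  GRing.isLinear.Build F (mform p) _ _ (@dform p) (@dform_is_linear p).

Lemma mem_cochains p (f : mform p) :
  reflect (forall (i j : 'I_p) t, j = i.+1 :> nat ->
             f (swap i j t) = - (-1) ^+ (par (t i) * par (t j)) * f t)
          (f \in cochains p).
Proof.
rewrite memv_ker lfunE /=; apply: (iffP eqP) => [f0 i j t ji|fP].
  have /ffunP/(_ (i, j, t)) := f0; rewrite !ffunE /= ji eqxx => /eqP.
  by rewrite addr_eq0 mulNr => /eqP.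
apply/ffunP=> -[[i j] t]; rewrite !ffunE /=; case: eqP => // ji.
by rewrite fP // mulNr addNr.
Qed.

Lemma dform1E (g : mform 1) (t : {ffun 'I_2 -> I}) :
  dform g t = - \sum_k lsBr (t ord0) (t ord_max) k * g [ffun=> k].
Proof.
rewrite ffunE; under eq_bigr do rewrite big_mkcond.
rewrite !big_ord_recl !big_ord0 /= !add0r !addr0.
have -> : lift ord0 ord0 = ord_max :> 'I_2 by apply/val_inj.
rewrite /sigma [X in (_ + _ * X + _)%N]big_pred0 //.
rewrite [X in (_ + _ * X)%N]big_mkcond !big_ord_recl big_ord0 /=.
rewrite (_ : (-1) ^+ _ = -1); last first.
  by case: (par _); case: (par _); rewrite -signr_odd.
rewrite mulN1r; congr (- _).
by apply: eq_bigr => k _; congr (_ * g _); apply/ffunP=> l; rewrite !ffunE ord1.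
Qed.

(* Hence the subtraction defining cohomology_dim 2 is not truncated. *)
Lemma coboundaries2_sub : (coboundaries 2 <= cocycles 2)%VS.
Proof.
apply/subvP=> _ /memv_imgP[g _ ->]; rewrite lfunE /= memv_cap; apply/andP; split.
  apply/mem_cochains => i j t ij.
  have -> : i = ord0 by apply/val_inj; case: i j ij => [[|[]]] //= ? [[|[|]]].
  have -> : j = ord_max by apply/val_inj; case: i j ij => [[|[]]] //= ? [[|[|]]].
  rewrite !dform1E !ffunE /= mulrNN mulr_sumr -sumrN; apply: eq_bigr => k _.
  by rewrite (lsBr_skew (t ord0) (t ord_max)) !mulNr opprK mulrA.
rewrite memv_ker lfunE /=; apply/eqP/ffunP=> t; rewrite [RHS]ffunE.
rewrite ffunE; under eq_bigr do rewrite big_mkcond.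
rewrite !big_ord_recl !big_ord0 /= !add0r !addr0.
have -> : lift ord0 (lift ord0 ord0) = ord_max :> 'I_3 by apply/val_inj.
set i1 := lift ord0 ord0.
have s01 : (-1) ^+ sigma t ord0 i1 = -1 :> F.
  rewrite /sigma [X in (_ + _ * X + _)%N]big_pred0 //.
  rewrite [X in (_ + _ * X)%N]big_mkcond !big_ord_recl big_ord0 /=.
  by rewrite -/i1; case: (par _); case: (par _); rewrite -signr_odd.
have s02 : (-1) ^+ sigma t ord0 ord_max
    = (-1) ^+ (par (t i1) * par (t ord_max)) :> F.
  rewrite /sigma [X in (_ + _ * X + _)%N]big_pred0 //.
  rewrite [X in (_ + _ * X)%N]big_mkcond !big_ord_recl big_ord0 /=.
  by rewrite -/i1; case: (par _); case: (par _); case: (par _);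
    rewrite -signr_odd /= ?expr1 ?opprK.
have s12 : (-1) ^+ sigma t i1 ord_max
    = - (-1) ^+ (par (t ord0) * (par (t i1) (+) par (t ord_max))) :> F.
  rewrite /sigma ![X in (_ + _ * X)%N]big_mkcond [X in (_ + _ * X + _)%N]big_mkcond.
  rewrite !big_ord_recl big_ord0 /=.
  by rewrite -/i1; case: (par _); case: (par _); case: (par _);
    rewrite -signr_odd /= ?expr1 ?opprK.
rewrite s01 s02 s12 {s01 s02 s12}.
have c01 k : dform g (contract t ord0 i1 k)
    = - \sum_l lsBr k (t ord_max) l * g [ffun=> l].
  rewrite dform1E !ffunE /= (_ : inord _ = ord_max) //.
  by apply/val_inj; rewrite /= inordK.
have c02 k : dform g (contract t ord0 ord_max k)
    = - \sum_l lsBr k (t i1) l * g [ffun=> l].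
  rewrite dform1E !ffunE /= (_ : inord _ = i1) //.
  by apply/val_inj; rewrite /= inordK.
have c12 k : dform g (contract t i1 ord_max k)
    = - \sum_l lsBr k (t ord0) l * g [ffun=> l].
  rewrite dform1E !ffunE /= (_ : inord _ = ord0) //.
  by apply/val_inj; rewrite /= inordK.
have swapr x y z : \sum_k lsBr x y k * - (\sum_l lsBr k z l * g [ffun=> l])
    = - \sum_l (\sum_k lsBr x y k * lsBr k z l) * g [ffun=> l] :> F.
  under eq_bigr do rewrite mulrN mulr_sumr.
  rewrite sumrN exchange_big; congr (- _); apply: eq_bigr => l _.
  by rewrite mulr_suml; apply: eq_bigr => k _; rewrite mulrA.
have skewr x y z l : \sum_k lsBr x y k * lsBr k z l
    = - (-1) ^+ (par z * (par x (+) par y)) * \sum_k lsBr x y k * lsBr z k l.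
  rewrite mulr_sumr; apply: eq_bigr => k _.
  case: (lsBr x y k =P 0) => [->|/eqP/lsBr_par <-]; first by rewrite !mul0r mulr0.
  by rewrite (lsBr_skew z k) mulrCA.
under eq_bigr do rewrite c01.
under [X in _ + _ * X + _]eq_bigr do rewrite c02.
under [X in _ + _ * X]eq_bigr do rewrite c12.
rewrite !swapr !mulrN !mulNr opprK mul1r opprK !mulr_sumr -sumrB -big_split /=.
apply: big1 => l _; rewrite !mulrA -mulrBl -mulrDl.
rewrite (skewr (t i1)) (skewr (t ord0) (t ord_max)) (lsBr_jacobi (t ord0)).
move: (\sum_k _) (\sum_k _) => A B.
by case: (par _); case: (par _); case: (par _);
  rewrite /= ?expr0 ?expr1 ?mulrN1 ?mulN1r ?opprK; ring.
Qed.

End Cohomology.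

Section Nilpotent.
Variables (F : fieldType) (n : nat).

(* gl(n|n) is 'M[F]_(n + n): the row (column) index \bar i is lshift n i, and
   i is rshift n i. *)
Definition idx_odd (a : 'I_(n + n)) : bool :=
  if split a is inr _ then true else false.

Definition idx_pos (a : 'I_(n + n)) : 'I_n :=
  match split a with inl i => i | inr i => i end.

Local Notation unit_idx := ('I_(n + n) * 'I_(n + n))%type.

Definition unit_par (x : unit_idx) : bool := idx_odd x.1 (+) idx_odd x.2.

Definition unit_mx (x : unit_idx) : 'M[F]_(n + n) := delta_mx x.1 x.2.

Definition unit_br (x y : unit_idx) : 'M[F]_(n + n) :=
  unit_mx x *m unit_mx y
  - (-1) ^+ (unit_par x * unit_par y) *: (unit_mx y *m unit_mx x).

Lemma unit_brE (a b c d : 'I_(n + n)) :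
  unit_br (a, b) (c, d) =
    (b == c)%:R *: delta_mx a d
    - (-1) ^+ (unit_par (a, b) * unit_par (c, d))
        *: ((d == a)%:R *: delta_mx c b).
Proof.
by rewrite /unit_br /unit_mx /= !mul_delta_mx_cond !scaler_nat.
Qed.

(* The basis of the subalgebra n: all E_ab whose unbarred indices satisfy
   i < j. *)
Definition nil_basis := {x : unit_idx | (idx_pos x.1 < idx_pos x.2)%N}.

Definition nil_par (x : nil_basis) : bool := unit_par (val x).

Definition nil_br (x y z : nil_basis) : F :=
  unit_br (val x) (val y) (val z).1 (val z).2.

Lemma unit_br_neq0 x y z : unit_br x y z.1 z.2 != 0 ->
  [\/ [/\ x.2 = y.1, z.1 = x.1 & z.2 = y.2]
    | [/\ y.2 = x.1, z.1 = y.1 & z.2 = x.2]].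
Proof.
case: x y z => [a b] [c d] [u v]; rewrite unit_brE !mxE /=.
case: (b =P c) => [bc|_]; case: (u =P a) => [ua|_]; case: (v =P d) => [vd|_];
  try (by move=> _; left); rewrite /= ?mulr0 ?mul0r sub0r oppr_eq0;
case: (d =P a) => [da|_]; case: (u =P c) => [uc|_]; case: (v =P b) => [vb|_];
  try (by move=> _; right); by rewrite /= ?mulr0 ?mul0r ?mulr0 eqxx.
Qed.

Lemma unit_br_par x y z :
  unit_br x y z.1 z.2 != 0 -> unit_par z = unit_par x (+) unit_par y.
Proof.
move=> /unit_br_neq0; rewrite /unit_par => -[] [-> -> ->].
  by rewrite addbA addbK.
by rewrite [RHS]addbC addbA addbK.
Qed.

Lemma unit_br_nil (x y : nil_basis) z :
  unit_br (val x) (val y) z.1 z.2 != 0 -> (idx_pos z.1 < idx_pos z.2)%N.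
Proof.
move=> /unit_br_neq0[] [e -> ->]; move: (valP x) (valP y); rewrite e => hx hy.
  exact: ltn_trans hx hy.
exact: ltn_trans hy hx.
Qed.

(* n is closed under the bracket and nil_br are its structure constants. *)
Lemma nil_br_sum (x y : nil_basis) :
  unit_br (val x) (val y) = \sum_z nil_br x y z *: unit_mx (val z).
Proof.
rewrite {1}(matrix_sum_delta (unit_br (val x) (val y))) pair_big /=.
pose P (z : unit_idx) := (idx_pos z.1 < idx_pos z.2)%N.
rewrite (bigID P) /= [X in _ + X]big1 ?addr0 => [|z nPz]; last first.
  case: (unit_br (val x) (val y) z.1 z.2 =P 0) => [->|/eqP/unit_br_nil Pz].
    by rewrite scale0r.
  by rewrite /P Pz in nPz.
rewrite (reindex_omap (val : nil_basis -> unit_idx) insub) /=; last first.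
  by move=> z Pz; rewrite insubT.
by apply: eq_bigl => z; rewrite valK eqxx andbT [P _](valP z).
Qed.

Lemma nil_br_par x y z : nil_br x y z != 0 -> nil_par z = nil_par x (+) nil_par y.
Proof. exact: unit_br_par. Qed.

Lemma nil_br_skew x y z :
  nil_br y x z = - (-1) ^+ (nil_par x * nil_par y) * nil_br x y z.
Proof.
rewrite /nil_br /unit_br /nil_par mulnC !mxE mulrBr !mulNr opprK mulrA.
by rewrite -signr_odd -expr2 sqrr_sign mul1r addrC.
Qed.

Lemma nil_jacobi_l x y z w :
  \sum_u nil_br y z u * nil_br x u w =
  (unit_mx (val x) *m unit_br (val y) (val z)
   - (-1) ^+ (nil_par x * (nil_par y (+) nil_par z))
     *: (unit_br (val y) (val z) *m unit_mx (val x))) (val w).1 (val w).2.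
Proof.
rewrite nil_br_sum mulmx_sumr mulmx_suml scaler_sumr -sumrB summxE.
apply: eq_bigr => u _.
case: (nil_br y z u =P 0) => [->|/eqP/nil_br_par <-].
  by rewrite !scale0r mul0r mulmx0 mul0mx scaler0 subr0 mxE.
rewrite -scalemxAr -scalemxAl scalerA [X in _ - X *: _]mulrC -scalerA -scalerBr.
by rewrite mxE.
Qed.

Lemma nil_jacobi_r x y z w :
  \sum_u nil_br x y u * nil_br u z w =
  (unit_br (val x) (val y) *m unit_mx (val z)
   - (-1) ^+ ((nil_par x (+) nil_par y) * nil_par z)
     *: (unit_mx (val z) *m unit_br (val x) (val y))) (val w).1 (val w).2.
Proof.
rewrite nil_br_sum mulmx_sumr mulmx_suml scaler_sumr -sumrB summxE.
apply: eq_bigr => u _.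
case: (nil_br x y u =P 0) => [->|/eqP/nil_br_par <-].
  by rewrite !scale0r mul0r mulmx0 mul0mx scaler0 subr0 mxE.
rewrite -scalemxAr -scalemxAl scalerA [X in _ - X *: _]mulrC -scalerA -scalerBr.
by rewrite mxE.
Qed.

Lemma nil_br_jacobi x y z w :
  \sum_u nil_br y z u * nil_br x u w =
  \sum_u nil_br x y u * nil_br u z w +
  (-1) ^+ (nil_par x * nil_par y) * \sum_u nil_br x z u * nil_br y u w.
Proof.
rewrite (nil_jacobi_l x y z) (nil_jacobi_l y x z) (nil_jacobi_r x y z) /unit_br.
rewrite -/(nil_par x) -/(nil_par y) -/(nil_par z).
move: (unit_mx (val x)) (unit_mx (val y)) (unit_mx (val z)) => X Y Z.
case: (val w) => a b /=.
rewrite !mulmxBr !mulmxBl -!scalemxAr -!scalemxAl !mulmxA.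
move: (X *m Y *m Z) (X *m Z *m Y) (Y *m X *m Z) (Y *m Z *m X) (Z *m X *m Y)
  (Z *m Y *m X) => A1 A2 A3 A4 A5 A6.
do 40?rewrite mxE.
move: (A1 a b) (A2 a b) (A3 a b) (A4 a b) (A5 a b) (A6 a b) => a1 a2 a3 a4 a5 a6.
case: (nil_par x); case: (nil_par y); case: (nil_par z);
  rewrite /= ?expr0 ?expr1; ring.
Qed.

Definition nil_superalgebra : lieSuperalgebra F :=
  @LieSuperalgebra F nil_basis nil_par nil_br
    nil_br_par nil_br_skew nil_br_jacobi.

End Nilpotent.

(* Main.v *)
(* The height of E_AB is the difference of the unbarred indices of B and A.
   Let f be a 2-cocycle.  If E_AC has height at least 2 and does not compose with
   y on either side, then E_AC = [E_AB, E_BC] for some B such that y commutes with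
   both factors, so f(E_AC, y) = 0.  If E_AC has height at least 3, the cocycle
   identity on E_AB, E_BB', E_B'C shows that f(E_AB, E_BC) does not depend on B.
   Hence f is determined by its values on pairs of height-1 elements, which are
   free because every bracket has height at least 2, together with one value for
   each basis element of height at least 3.  A coboundary is determined by one
   value for each basis element of height at least 2.  There are 2(n-1) even and
   2(n-1) odd elements of height 1 and 4(n-2) elements of height 2, so the
   dimension of H^2 is 8(n-1)^2 - 4(n-2). *)

From HB Require Import structures.
Require Import Defs.
From mathcomp Require Import all_boot all_order all_algebra.
From mathcomp Require Import complex.
From mathcomp Require Import reals.
From mathcomp Require Import zify.

Set Implicit Arguments.
Unset Strict Implicit.
Unset Printing Implicit Defensive.

Import GRing.Theory.
Local Open Scope ring_scope.

(** Evaluation at the points [tau k] maps [U] linearly to the functions on [K]. The last hypothesis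
    makes it injective, and [s] supplies a preimage in [U] of every function. Both dimension counts
    use this. *)
Lemma dim_by_evaluation (F : fieldType) (T K : finType)
    (U : {vspace {ffun T -> F^o}}) (tau : K -> T)
    (s : {ffun K -> F^o} -> {ffun T -> F^o}) :
    (forall c, s c \in U) ->
    (forall c k, s c (tau k) = c k) ->
    (forall u, u \in U -> (forall k, u (tau k) = 0) -> u = 0) ->
  \dim U = #|K|.
Proof.
move=> sU sK evU0.
pose ev (u : {ffun T -> F^o}) : {ffun K -> F^o} := [ffun k => u (tau k)].
have lin_ev : linear ev by move=> a u v; apply/ffunP=> k; rewrite !ffunE.
pose evL := GRing.isLinear.Build _ _ _ _ ev lin_ev.
pose r : {linear {ffun T -> F^o} -> {ffun K -> F^o}} := HB.pack ev evL.
have ker0 : (U :&: lker (linfun r) = 0)%VS.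
  apply/eqP; rewrite -subv0; apply/subvP=> u; rewrite memv_cap memv_ker lfunE /=.
  case/andP=> Uu /eqP/ffunP u0; rewrite memv0; apply/eqP; apply: evU0 => // k.
  by have := u0 k; rewrite !ffunE.
have im : (linfun r @: U = fullv)%VS.
  apply/eqP; rewrite eqEsubv subvf; apply/subvP=> c _.
  have -> : c = linfun r (s c).
    by rewrite lfunE; apply/ffunP=> k; rewrite ffunE sK.
  exact: memv_img.
by rewrite -(limg_dim_eq ker0) im dimvf /dim /= muln1.
Qed.

(** * 2-cochains and 2-cocycles of an arbitrary Lie superalgebra *)

Section TwoCochains.
Variables (F : fieldType) (L : lieSuperalgebra F).
Local Notation I := (lsBasis L).
Local Notation par := (@lsPar F L).
Local Notation br := (@lsBr F L).

Definition tuple2 (x y : I) : {ffun 'I_2 -> I} :=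
  [ffun i => if i == ord0 then x else y].

Definition tuple3 (x y z : I) : {ffun 'I_3 -> I} :=
  [ffun i : 'I_3 => if val i == 0%N then x else if val i == 1%N then y else z].

Lemma tuple2_eta (t : {ffun 'I_2 -> I}) : t = tuple2 (t ord0) (t ord_max).
Proof.
apply/ffunP=> i; rewrite ffunE; case: eqP => [-> //|i0]; congr (t _).
by apply/val_inj; case: i i0 => [[|[|]]] //= i i0; case: i0; apply/val_inj.
Qed.

Lemma cochains2P (f : mform L 2) :
  reflect (forall x y, f (tuple2 y x) = - (-1) ^+ (par x * par y) * f (tuple2 x y))
          (f \in cochains L 2).
Proof.
apply: (iffP (mem_cochains f)) => [fP x y | fP i j t ij].
  have := fP ord0 ord_max (tuple2 x y) erefl.
  rewrite [X in f X](_ : _ = tuple2 y x); first by rewrite !ffunE.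
  by rewrite [LHS]tuple2_eta !ffunE.
have -> : i = ord0 by apply/val_inj; case: i j ij => [[|[]]] //= ? [[|[|]]].
have -> : j = ord_max by apply/val_inj; case: i j ij => [[|[]]] //= ? [[|[|]]].
have := fP (t ord0) (t ord_max); rewrite -tuple2_eta => <-; congr (f _).
by rewrite [LHS]tuple2_eta !ffunE.
Qed.

Lemma dform2E (f : mform L 2) x y z :
  dform f (tuple3 x y z) =
    - (\sum_k br x y k * f (tuple2 k z))
    + (-1) ^+ (par y * par z) * (\sum_k br x z k * f (tuple2 k y))
    - (-1) ^+ (par x * (par y (+) par z)) * (\sum_k br y z k * f (tuple2 k x)).
Proof.
set t := tuple3 x y z.
rewrite ffunE; under eq_bigr do rewrite big_mkcond.
rewrite !big_ord_recl !big_ord0 /= !add0r !addr0.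
have -> : lift ord0 (lift ord0 ord0) = ord_max :> 'I_3 by apply/val_inj.
set i1 := lift ord0 ord0.
have [t0 t1 t2] : [/\ t ord0 = x, t i1 = y & t ord_max = z] by rewrite !ffunE.
have -> : (-1) ^+ sigma t ord0 i1 = -1 :> F.
  rewrite /sigma [X in (_ + _ * X + _)%N]big_pred0 //.
  rewrite [X in (_ + _ * X)%N]big_mkcond !big_ord_recl big_ord0 /=.
  by rewrite -/i1; case: (par _); case: (par _); rewrite -signr_odd.
have -> : (-1) ^+ sigma t ord0 ord_max
    = (-1) ^+ (par (t i1) * par (t ord_max)) :> F.
  rewrite /sigma [X in (_ + _ * X + _)%N]big_pred0 //.
  rewrite [X in (_ + _ * X)%N]big_mkcond !big_ord_recl big_ord0 /=.
  by rewrite -/i1; case: (par _); case: (par _); case: (par _);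
    rewrite -signr_odd /= ?expr1 ?opprK.
have -> : (-1) ^+ sigma t i1 ord_max
    = - (-1) ^+ (par (t ord0) * (par (t i1) (+) par (t ord_max))) :> F.
  rewrite /sigma ![X in (_ + _ * X)%N]big_mkcond [X in (_ + _ * X + _)%N]big_mkcond.
  rewrite !big_ord_recl big_ord0 /=.
  by rewrite -/i1; case: (par _); case: (par _); case: (par _);
    rewrite -signr_odd /= ?expr1 ?opprK.
rewrite t0 t1 t2 mulN1r mulNr; congr (- _ + _ * _ - _ * _);
  apply: eq_bigr => k _; congr (_ * f _);
  apply/ffunP=> l; rewrite !ffunE /=;
  by case: l => [[|[|]]] //= ?; rewrite !inordK.
Qed.

Lemma tuple3_eta (t : {ffun 'I_3 -> I}) :
  t = tuple3 (t ord0) (t (lift ord0 ord0)) (t ord_max).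
Proof.
apply/ffunP=> -[[|[|[|]]] //= lti]; rewrite ffunE /=; congr (t _);
  exact/val_inj.
Qed.

Lemma dform1_tuple2 (g : mform L 1) x y :
  dform g (tuple2 x y) = - \sum_k br x y k * g [ffun=> k].
Proof. by rewrite dform1E !ffunE. Qed.

Lemma mem_cocycles2 (f : mform L 2) :
  reflect (f \in cochains L 2 /\ forall x y z, dform f (tuple3 x y z) = 0)
          (f \in cocycles L 2).
Proof.
rewrite memv_cap memv_ker lfunE /=.
apply: (iffP andP) => -[fC df]; split=> //.
  by move=> x y z; rewrite (eqP df) ffunE.
by apply/eqP/ffunP=> t; rewrite (tuple3_eta t) df ffunE.
Qed.

Lemma dform_coboundaries2 (g : mform L 1) : dform g \in coboundaries L 2.
Proof.
rewrite -[dform g](lfunE (@dform F L 1)); apply: memv_img.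
by apply/mem_cochains => i j t; rewrite (ord1 i) (ord1 j).
Qed.

Lemma cochain2_even_diag (f : mform L 2) x :
  2%:R != 0 :> F -> f \in cochains L 2 -> ~~ par x -> f (tuple2 x x) = 0.
Proof.
move=> F2 /cochains2P/(_ x x) fxx /negbTE px; move: fxx.
rewrite px expr0 mulN1r => /eqP.
by rewrite -addr_eq0 -mulr2n -mulr_natl mulf_eq0 (negbTE F2) => /eqP.
Qed.

End TwoCochains.

Section ExtendByZero.
Variables (F : fieldType) (T : finType) (P : pred T).
Implicit Type c : {ffun {x : T | P x} -> F^o}.

Definition extend0 c x : F := if insub x is Some u then c u else 0.

Lemma extend0_val c u : extend0 c (val u) = c u.
Proof. by rewrite /extend0 valK. Qed.

Lemma extend0_out c x : ~~ P x -> extend0 c x = 0.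
Proof. by move=> Px; rewrite /extend0 insubN. Qed.

End ExtendByZero.

(** * Brackets in the nilpotent subalgebra and the relations they impose on 2-cocycles *)

Section NilCocycles.
Variables (F : fieldType) (n : nat).
Local Notation I := (Defs.nil_basis n).
Local Notation N := (nil_superalgebra F n).
Local Notation tup2 := (@tuple2 F N).
Local Notation src x := (val (x : I)).1.
Local Notation tgt x := (val (x : I)).2.
Implicit Types (x y z : I) (f : mform N 2).

Definition height x : nat := (idx_pos (tgt x) - idx_pos (src x))%N.

Lemma nil_basis_unit (A B : 'I_(n + n)) :
  (idx_pos A < idx_pos B)%N -> exists x : I, val x = (A, B).
Proof. by move=> lt_AB; exists (Sub (A, B) lt_AB); rewrite SubK. Qed.

(** Positions strictly increase along [x] and then [y], so the product in the opposite order is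
    zero. Hence [[x, y]] is the basis vector [z] with coefficient 1, whatever the parities. *)
Lemma sum_br_comp x y z (G : I -> F) :
  tgt x = src y -> val z = (src x, tgt y) -> \sum_k nil_br F x y k * G k = G z.
Proof.
move=> xy zE; rewrite (bigD1 z) //= [X in _ + X]big1 ?addr0 => [|k k'z].
  rewrite /nil_br; move: (valP x) (valP y) xy zE.
  case: (val x) (val y) (val z) => [A B] [C D] [u v] /= AB BD eBC [-> ->].
  rewrite unit_brE eBC eqxx.
  have /negbTE-> : D != A.
    apply/eqP=> eDA; move: AB BD; rewrite eBC eDA => /ltn_trans/[apply].
    by rewrite ltnn.
  by rewrite scale0r scaler0 subr0 scale1r mxE !eqxx mul1r.
case: (nil_br F x y k =P 0) => [->|/eqP/unit_br_neq0]; first by rewrite mul0r.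
case=> -[exy e1 e2].
  by case/eqP: k'z; apply/val_inj; rewrite zE [LHS]surjective_pairing e1 e2.
move: (valP x) (valP y); rewrite exy xy => ltx lty.
by have := ltn_trans ltx lty; rewrite ltnn.
Qed.

Lemma sum_br_comm x y (G : I -> F) :
  tgt x != src y -> tgt y != src x -> \sum_k nil_br F x y k * G k = 0.
Proof.
move=> xy yx; apply: big1 => k _.
case: (nil_br F x y k =P 0) => [->|/eqP/unit_br_neq0]; first by rewrite mul0r.
by case=> -[e]; rewrite e eqxx in xy yx.
Qed.

Lemma nil_br_height x y z : nil_br F x y z != 0 -> (1 < height z)%N.
Proof.
move=> /unit_br_neq0[] [e e1 e2]; rewrite /height e1 e2;
  move: (valP x) (valP y); rewrite e; lia.
Qed.

Lemma cocycle_comm f x y : f \in cocycles N 2 -> (1 < height x)%N ->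
  tgt x != src y -> tgt y != src x -> f (tup2 x y) = 0.
Proof.
case/mem_cocycles2=> _ df htx xy yx.
(* [J] is taken one position after [src x]. The ends of [y] lie at different positions, so at most
   one of the two indices there, barred or unbarred, is an end of [y]; the other one serves. *)
have [J [ltxJ ltJx Jy yJ]] : exists J : 'I_(n + n),
    [/\ (idx_pos (src x) < idx_pos J)%N, (idx_pos J < idx_pos (tgt x))%N,
        J != src y & tgt y != J].
  have ltj : ((idx_pos (src x)).+1 < n)%N.
    by have := ltn_ord (idx_pos (tgt x)); move: htx; rewrite /height; lia.
  pose j := Ordinal ltj.
  have posl : idx_pos (lshift n j) = j by rewrite /idx_pos (unsplitK (inl j)).
  have posr : idx_pos (rshift n j) = j by rewrite /idx_pos (unsplitK (inr j)).
  have lr : lshift n j != rshift n j by rewrite eq_lrshift.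
  have ltj1 : (j < idx_pos (tgt x))%N by move: htx; rewrite /height /=; lia.
  have lty := valP y.
  have [sy|sy] := eqVneq (idx_pos (src y)) j.
    have ty J : idx_pos J = j -> tgt y != J.
      by move=> eJ; apply/eqP=> tyJ; move: lty; rewrite tyJ sy eJ ltnn.
    have [le|lne] := eqVneq (lshift n j) (src y).
      by exists (rshift n j); rewrite posr -le eq_sym lr ty //; split.
    by exists (lshift n j); rewrite posl lne ty //; split.
  have ty J : idx_pos J = j -> J != src y.
    by move=> eJ; apply: contraNneq sy => <-; rewrite eJ.
  have [le|lne] := eqVneq (tgt y) (lshift n j).
    by exists (rshift n j); rewrite posr le lr ty //; split.
  by exists (lshift n j); rewrite posl lne ty //; split.
have [a aE] := nil_basis_unit ltxJ; have [b bE] := nil_basis_unit ltJx.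
(* Here [x = [a, b]] and [y] commutes with both [a] and [b], so only the term in [f(x, y)]
   survives. *)
have := df a b y; rewrite dform2E.
rewrite [X in - X](@sum_br_comp a b x (fun k => f (tup2 k y))) ?aE ?bE //=;
  last exact: surjective_pairing.
rewrite (@sum_br_comm a y) ?aE // (@sum_br_comm b y) ?bE //.
by rewrite !mulr0 addr0 subr0 => /eqP; rewrite oppr_eq0 => /eqP.
Qed.

(** Since [[a, c] = 0], the cocycle identity on [a, b, c] relates [f([a, b], c)] to [f([b, c], a)].
    The sign in that identity is the one produced by exchanging [a] and [[b, c]], so the two
    cancel. *)
Lemma cocycle_assoc f a b c ab bc : f \in cocycles N 2 ->
    tgt a = src b -> tgt b = src c ->
    val ab = (src a, tgt b) -> val bc = (src b, tgt c) ->
  f (tup2 ab c) = f (tup2 a bc).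
Proof.
case/mem_cocycles2=> /cochains2P fC df eab ebc abE bcE.
have ltab : (idx_pos (src a) < idx_pos (src b))%N by rewrite -eab (valP a).
have ltbc : (idx_pos (src b) < idx_pos (src c))%N by rewrite -ebc (valP b).
have ltc : (idx_pos (src c) < idx_pos (tgt c))%N by exact: (valP c).
have := df a b c; rewrite dform2E.
rewrite [X in - X](@sum_br_comp a b ab (fun k => f (tup2 k c))) //.
rewrite [X in _ - _ * X](@sum_br_comp b c bc (fun k => f (tup2 k a))) //.
rewrite (@sum_br_comm a c); first last.
- by apply/eqP=> e; have := ltn_trans (ltn_trans ltab ltbc) ltc; rewrite e ltnn.
- by rewrite eab; apply/eqP=> e; move: ltbc; rewrite e ltnn.
have pbc : lsPar (l := N) bc = lsPar (l := N) b (+) lsPar (l := N) c.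
  by rewrite /= /nil_par /unit_par bcE /= ebc addbA addbK.
rewrite mulr0 addr0 (fC a bc) pbc !mulNr mulrN opprK mulrA -expr2 sqrr_sign mul1r.
by move/eqP; rewrite addrC subr_eq0 => /eqP.
Qed.

Lemma ord_between_avoiding (i k l : 'I_n) : (2 < k - i)%N ->
  exists j : 'I_n, [/\ (i < j)%N, (j < k)%N & j != l].
Proof.
move=> ik; have lt1 : (i.+1 < n)%N by have := ltn_ord k; lia.
have lt2 : (i.+2 < n)%N by have := ltn_ord k; lia.
have [e|ne] := eqVneq (Ordinal lt1) l.
  by exists (Ordinal lt2); rewrite -e -val_eqE /=; split; lia.
by exists (Ordinal lt1); split=> //=; lia.
Qed.

Lemma cocycle_comp f x y x' y' : f \in cocycles N 2 ->
    tgt x = src y -> tgt x' = src y' -> src x = src x' -> tgt y = tgt y' ->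
    (2 < idx_pos (tgt y) - idx_pos (src x))%N ->
  f (tup2 x y) = f (tup2 x' y').
Proof.
move=> fZ.
(* When the cut indices lie at different positions, a basis element [b] joins them, and
   [cocycle_assoc] on [u, b, v'] applies. *)
have step u v u' v' : tgt u = src v -> tgt u' = src v' -> src u = src u' ->
    tgt v = tgt v' -> (idx_pos (tgt u) < idx_pos (tgt u'))%N ->
    f (tup2 u v) = f (tup2 u' v').
  move=> uv uv' su tv ltu; have [b bE] := nil_basis_unit ltu.
  apply/esym/(@cocycle_assoc f u b v' u' v fZ); rewrite ?bE //=.
    by rewrite su -surjective_pairing.
  by rewrite uv -tv -surjective_pairing.
move=> xy xy' sx ty ht.
have [lt|gt|eq] := ltngtP (idx_pos (tgt x)) (idx_pos (tgt x')).
- exact: step.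
- exact/esym/step.
(* The cut indices may be the barred and unbarred index of one position, which no basis element
   joins. Total height at least 3 leaves room for another position [j], and both cuts are compared
   with the one there. *)
have [j [ltxj ltjy jx]] := ord_between_avoiding (idx_pos (tgt x)) ht.
have posl : idx_pos (lshift n j) = j by rewrite /idx_pos (unsplitK (inl j)).
have [|u uE] := @nil_basis_unit (src x) (lshift n j); first by rewrite posl.
have [|v vE] := @nil_basis_unit (lshift n j) (tgt y); first by rewrite posl.
have uv w w' : tgt w = src w' -> src w = src x -> tgt w' = tgt y ->
    idx_pos (tgt w) = idx_pos (tgt x) :> nat -> f (tup2 w w') = f (tup2 u v).
  move=> ww' sw tw' ew; have [lt|gt|e] := ltngtP j (idx_pos (tgt x)).
  - by apply/esym/step; rewrite ?uE ?vE //= posl ew.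
  - by apply/step; rewrite ?uE ?vE //= posl ew.
  - by case/eqP: jx; apply/val_inj.
by rewrite (uv x y) // (uv x' y') // -eq.
Qed.

(* Junk unless [1 < height x]: [insubd] then falls back on its default. *)
Definition cut_pos x : 'I_(n + n) :=
  lshift n (insubd (idx_pos (src x)) (idx_pos (src x)).+1).
Definition cut_l x : I := insubd x (src x, cut_pos x).
Definition cut_r x : I := insubd x (cut_pos x, tgt x).

Lemma cutP x : (1 < height x)%N ->
  [/\ tgt (cut_l x) = src (cut_r x), src (cut_l x) = src x,
      tgt (cut_r x) = tgt x & height (cut_r x) = (height x).-1].
Proof.
rewrite /height => ht.
have ltj : ((idx_pos (src x)).+1 < n)%N.
  by have := ltn_ord (idx_pos (tgt x)); lia.
have pos : idx_pos (cut_pos x) = (idx_pos (src x)).+1 :> nat.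
  rewrite /cut_pos /idx_pos (unsplitK (inl _)) /=.
  by rewrite insubdK.
have lt_l : (idx_pos (src x) < idx_pos (cut_pos x))%N by rewrite pos.
have lt_r : (idx_pos (cut_pos x) < idx_pos (tgt x))%N by rewrite pos; lia.
have lE : val (cut_l x) = (src x, cut_pos x) by rewrite /cut_l insubdK.
have rE : val (cut_r x) = (cut_pos x, tgt x) by rewrite /cut_r insubdK.
have ht_r : (idx_pos (tgt x) - idx_pos (cut_pos x)
             = (idx_pos (tgt x) - idx_pos (src x)).-1)%N by rewrite pos subnS.
by rewrite lE rE; split.
Qed.

Definition cut x : {ffun 'I_2 -> I} := tup2 (cut_l x) (cut_r x).

Lemma dform1_comp (g : mform N 1) x y z :
  tgt x = src y -> val z = (src x, tgt y) ->
  dform g (tup2 x y) = - g [ffun=> z].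
Proof.
move=> xy zE; rewrite dform1_tuple2; congr (- _).
exact: (@sum_br_comp x y z (fun k => g [ffun=> k])).
Qed.

Lemma dform1_cut (g : mform N 1) x :
  (1 < height x)%N -> dform g (cut x) = - g [ffun=> x].
Proof.
case/cutP=> lr l r _; apply: dform1_comp => //.
by rewrite l r -surjective_pairing.
Qed.

(** * Dimensions of the spaces of 2-coboundaries and 2-cocycles *)

Definition functional (h : I -> F) : mform N 1 :=
  [ffun t : {ffun 'I_1 -> lsBasis N} => h (t ord0) : F^o].

Lemma dim_nil_coboundaries2 :
  \dim (coboundaries N 2) = #|[pred x : I | (1 < height x)%N]|.
Proof.
pose K := {x : I | (1 < height x)%N}.
rewrite -[RHS]card_sig -/K.
(* The minus sign cancels the one in [dform1_cut]. *)
pose g (c : {ffun K -> F^o}) := functional (fun x => - extend0 c x).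
apply: (@dim_by_evaluation _ _ _ _ (fun k : K => cut (val k))
          (fun c => dform (g c))).
- by move=> c; exact: (dform_coboundaries2 (g c)).
- move=> c k; rewrite dform1_cut ?(valP k) // !ffunE opprK.
  exact: extend0_val.
move=> _ /memv_imgP[h _ ->]; rewrite lfunE /= => h0.
have {}h0 z : (1 < height z)%N -> h [ffun=> z] = 0.
  move=> ht; have := h0 (Sub z ht); rewrite SubK dform1_cut // => /eqP.
  by rewrite oppr_eq0 => /eqP.
apply/ffunP=> t; rewrite (@dform1E _ N) ffunE big1 ?oppr0 // => k _.
have [->|/nil_br_height ht] := eqVneq (lsBr (l := N) (t ord0) (t ord_max) k) 0.
  by rewrite mul0r.
by rewrite h0 // mulr0.
Qed.

(* Representatives of the pairs of height-1 elements up to exchange; a pair (x, x)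
   with x even is left out because skew-symmetry forces f(x, x) = 0. *)
Definition simple_pair (p : I * I) : bool :=
  [&& height p.1 == 1%N, height p.2 == 1%N &
      (enum_rank p.1 < enum_rank p.2)%N || (p.1 == p.2) && nil_par p.1].

Definition skew_extension (c : {ffun {p | simple_pair p} -> F^o}) : mform N 2 :=
  [ffun t : {ffun 'I_2 -> lsBasis N} =>
    let x : I := t ord0 in let y : I := t ord_max in
    if (enum_rank x <= enum_rank y)%N then extend0 c (x, y) : F^o
    else - (-1) ^+ (nil_par x * nil_par y) * extend0 c (y, x)].

Lemma skew_extensionE c x y :
  skew_extension c (tup2 x y) =
    if (enum_rank x <= enum_rank y)%N then extend0 c (x, y)
    else - (-1) ^+ (nil_par x * nil_par y) * extend0 c (y, x).
Proof. by rewrite !ffunE /=. Qed.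

Lemma skew_extension_eq0 c x y :
  (height x != 1%N) || (height y != 1%N) -> skew_extension c (tup2 x y) = 0.
Proof.
move=> hxy; rewrite skew_extensionE !extend0_out ?mulr0 ?if_same //;
  rewrite /simple_pair /=; move: hxy;
  by case: (_ == 1%N); case: (_ == 1%N).
Qed.

Lemma skew_extension_cocycle c : skew_extension c \in cocycles N 2.
Proof.
apply/mem_cocycles2; split=> [|x y z].
  apply/cochains2P => x y; rewrite !skew_extensionE mulnC.
  case: ltngtP => // [lt|e].
    by rewrite mulrA mulrNN -expr2 sqrr_sign mul1r.
  have -> : y = x by apply/enum_rank_inj/val_inj.
  (* On the diagonal the skew-symmetry factor is 1 for odd [x]. For even [x] the pair is not simple,
     so the value is 0. *)
  rewrite /=; have [px|px] := boolP (nil_par x).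
    by rewrite -[X in _ ^+ X]/1%N expr1 opprK mul1r.
  by rewrite extend0_out ?mulr0 // /simple_pair /= ltnn (negbTE px) !andbF.
rewrite dform2E.
(* Every term of the differential evaluates the form on a bracket, which has height at least 2,
   where the form vanishes. *)
have br0 u v w : \sum_k lsBr (l := N) u v k * skew_extension c (tup2 k w) = 0.
  apply: big1 => k _.
  have [->|/nil_br_height ht] := eqVneq (lsBr (l := N) u v k) 0.
    by rewrite mul0r.
  by rewrite skew_extension_eq0 ?mulr0 // neq_ltn ht orbT.
by rewrite !br0 !mulr0 subr0 addr0 oppr0.
Qed.

(** The coordinates of a cocycle are its values on simple pairs and at [cut x] for [x] of height at
    least 3. Prescribed values are realised by a skew extension plus a coboundary; neither summand
    affects the coordinates of the other kind. *)
Lemma dim_nil_cocycles2 : 2%:R != 0 :> F ->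
  \dim (cocycles N 2) =
    (#|[pred p | simple_pair p]| + #|[pred x : I | (2 < height x)%N]|)%N.
Proof.
move=> F2.
pose K1 := {p | simple_pair p}; pose K2 := {x : I | (2 < height x)%N}.
have <- : #|{: K1}| = #|[pred p | simple_pair p]| by rewrite card_sig.
have <- : #|{: K2}| = #|[pred x : I | (2 < height x)%N]| by rewrite card_sig.
rewrite -card_sum.
pose tau (k : K1 + K2) : {ffun 'I_2 -> I} :=
  match k with inl p => tup2 (val p).1 (val p).2 | inr x => cut (val x) end.
pose c1 (c : {ffun K1 + K2 -> F^o}) := [ffun p => c (inl p)].
pose c2 (c : {ffun K1 + K2 -> F^o}) := [ffun x => c (inr x)].
pose g c := functional (fun x => - extend0 (c2 c) x).
apply: (@dim_by_evaluation _ _ _ _ tau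
          (fun c => skew_extension (c1 c) + dform (g c))).
- move=> c; apply: memvD; first exact: skew_extension_cocycle.
  by apply: (subvP (coboundaries2_sub N)); exact: (dform_coboundaries2 (g c)).
- move=> c [[[x y] p] | [x ht]]; rewrite ffunE /tau /=.
    have /and3P[/= /eqP hx /eqP hy xy] := p.
    have -> : skew_extension (c1 c) (tup2 x y) = c (inl (exist _ (x, y) p)).
      rewrite skew_extensionE ifT.
        by rewrite -[(x, y)]/(val (exist _ (x, y) p : K1)) extend0_val ffunE.
      by case/orP: xy => [/ltnW //|/andP[/eqP-> _]].
    rewrite (@dform1_tuple2 _ N (g c) x y) big1 ?oppr0 ?addr0 // => k _.
    have [->|k0] := eqVneq (lsBr (l := N) x y k) 0; first by rewrite mul0r.
    (* A bracket of two height-1 elements has height 2, while [g c] is supported on height at least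
       3. *)
    rewrite !ffunE extend0_out ?oppr0 ?mulr0 //.
    case/unit_br_neq0: k0 => -[e e1 e2];
      move: hx hy; rewrite /height e1 e2 e; lia.
  have ht1 := ltnW ht; have [_ _ _ hr] := cutP ht1.
  (* [cut] splits off a left factor of height 1, so the right factor has height at least 2 and the
     skew extension vanishes on this pair. *)
  rewrite dform1_cut // skew_extension_eq0 ?add0r; last first.
    by apply/orP; right; rewrite hr; move: ht; case: (height x) => [|[|[]]].
  rewrite !ffunE opprK.
  by rewrite -[x in LHS]/(val (exist _ x ht : K2)) extend0_val ffunE.
move=> f fZ f0; have [fC _] := elimT (@mem_cocycles2 _ N f) fZ.
have sk := elimT (@cochains2P _ N f) fC.
have comp0 x y : tgt x = src y -> (2 < idx_pos (tgt y) - idx_pos (src x))%N ->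
    f (tup2 x y) = 0.
  move=> xy ht; have ltxy : (idx_pos (src x) < idx_pos (tgt y))%N by lia.
  have [z zE] := nil_basis_unit ltxy.
  have htz : (2 < height z)%N by rewrite /height zE.
  have [lr l r _] := cutP (ltnW htz); rewrite zE /= in l r.
  by rewrite -(f0 (inr (Sub z htz))) /=; apply: cocycle_comp.
have skew0 x y : f (tup2 y x) = 0 -> f (tup2 x y) = 0.
  by move=> fyx; rewrite sk fyx mulr0.
(* If the two elements compose in either order, their heights add up to at least 3 and [comp0]
   applies; otherwise they commute. *)
have high0 x y : (1 < height x)%N -> f (tup2 x y) = 0.
  move=> ht; move: (ht); rewrite /height => ht'.
  have lty : (idx_pos (src y) < idx_pos (tgt y))%N := valP y.
  have [xy|xy] := eqVneq (tgt x) (src y).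
    by apply: comp0 => //; move: ht'; rewrite xy; lia.
  have [yx|yx] := eqVneq (tgt y) (src x).
    by apply/skew0/comp0 => //; move: ht'; rewrite -yx; lia.
  exact: cocycle_comm.
have pos x : (0 < height x)%N by rewrite /height subn_gt0 (valP x).
have rank0 x y : height x = 1%N -> height y = 1%N ->
    (enum_rank x <= enum_rank y)%N -> f (tup2 x y) = 0.
  move=> hx hy; rewrite leq_eqVlt => /orP[/eqP/val_inj/enum_rank_inj <-|lt].
    have [px|px] := boolP (nil_par x); last first.
      exact: (@cochain2_even_diag _ N f x F2 fC px).
    have p : simple_pair (x, x) by rewrite /simple_pair /= hx !eqxx px orbT.
    exact: (f0 (inl (exist _ (x, x) p))).
  have p : simple_pair (x, y) by rewrite /simple_pair /= hx hy lt.
  exact: (f0 (inl (exist _ (x, y) p))).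
apply/ffunP=> t; rewrite ffunE [t](@tuple2_eta _ N).
move: (t ord0) (t ord_max) => x y.
have [hx|hx] := ltnP 1 (height x); first exact: high0.
have [hy|hy] := ltnP 1 (height y); first exact/skew0/high0.
have {}hx : height x = 1%N by apply/eqP; rewrite eqn_leq hx pos.
have {}hy : height y = 1%N by apply/eqP; rewrite eqn_leq hy pos.
have [le|/ltnW le] := leqP (enum_rank x) (enum_rank y); first exact: rank0.
exact/skew0/rank0.
Qed.

End NilCocycles.

(** Let [U] count the increasing pairs in [S] and [D] the elements of [S] satisfying [O]. The
    selected pairs number [U + D], while splitting all ordered pairs into increasing, decreasing and
    diagonal ones gives [#|S| ^ 2 = U + U + #|S|]. Doubling avoids a division. *)
Lemma card_skew_pairs (T : finType) (S O : pred T) :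
  (#|[pred p : T * T | [&& S p.1, S p.2 &
      (enum_rank p.1 < enum_rank p.2) || (p.1 == p.2) && O p.1]]| * 2 + #|S|
   = #|S| ^ 2 + #|[pred x | S x && O x]| * 2)%N.
Proof.
pose lt (x y : T) : bool := (enum_rank x < enum_rank y)%N.
have ltxx x : lt x x = false by rewrite /lt ltnn.
pose D := #|[pred x | S x && O x]|.
pose U := (\sum_(x | S x) \sum_(y | S y) lt x y)%N.
have diag (G : T -> bool) :
    (\sum_(x | S x) \sum_(y | S y) ((x == y) && G x : nat)
      = #|[pred x | S x && G x]|)%N.
  rewrite -sum1_card big_mkcondr; apply: eq_bigr => x Sx.
  rewrite (bigD1 x) //= eqxx big1 ?addn0; first by case: (G x).
  by move=> y /andP[_ /negbTE yx]; rewrite eq_sym yx.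
have -> : #|[pred p : T * T | [&& S p.1, S p.2 &
    (enum_rank p.1 < enum_rank p.2)%N || (p.1 == p.2) && O p.1]]| = (U + D)%N.
  rewrite /U /D -(diag O) -big_split /= -[LHS]sum1_card.
  rewrite [LHS](eq_bigl (fun p : T * T => (S p.1 && S p.2) &&
    (lt p.1 p.2 || (p.1 == p.2) && O p.1))); last by move=> p; rewrite inE andbA.
  rewrite big_mkcondr -(pair_big S S (fun x y =>
    if lt x y || (x == y) && O x then 1 else 0)%N) /=.
  apply: eq_bigr => x Sx; rewrite -big_split; apply: eq_bigr => y Sy /=.
  have [->|_] := eqVneq x y; first by rewrite ltxx add0n; case: (O y).
  by rewrite orbF addn0; case: (lt x y).
have -> : (#|S| ^ 2 = U + U + #|S|)%N.
  have SE : #|S| = #|[pred x | S x && true]|.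
    by apply: eq_card => x; rewrite !inE andbT.
  have UE : U = (\sum_(x | S x) \sum_(y | S y) lt y x)%N by rewrite /U exchange_big.
  rewrite {2}SE -(diag xpredT) {2}UE /U -!big_split /=.
  rewrite expnS expn1 -[X in (X * _)%N]sum1_card big_distrl /=.
  apply: eq_bigr => x _; rewrite mul1n -[LHS]sum1_card -!big_split.
  apply: eq_bigr => y _ /=; rewrite andbT -(inj_eq enum_rank_inj) -val_eqE /lt /=.
  by case: ltngtP.
by rewrite -/D; lia.
Qed.

(** * Counting basis elements by height and parity *)

Section Counting.
Variable n : nat.
Local Notation I := (Defs.nil_basis n).

Lemma sum_nil_basis (G : 'I_(n + n) -> 'I_(n + n) -> nat) :
  (\sum_(x : I) G (val x).1 (val x).2
   = \sum_A \sum_(B | idx_pos A < idx_pos B) G A B)%N.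
Proof.
rewrite pair_big_dep /=.
rewrite [RHS](reindex_omap (val : I -> _) insub) /=; last first.
  by move=> z Pz; rewrite insubT.
by apply: eq_bigl => z; rewrite valK eqxx andbT; exact/esym/(valP z).
Qed.

Lemma count_diagonal h : (0 < h)%N ->
  (\sum_(i < n) \sum_(j < n | i < j) (j - i == h)%N = n - h)%N.
Proof.
move=> h0; transitivity (\sum_(i < n) (i < n - h))%N.
  apply: eq_bigr => i _; case: ltnP => ih.
    have ltj : (i + h < n)%N by lia.
    rewrite (bigD1 (Ordinal ltj)) /=; last by lia.
    rewrite addKn eqxx big1 // => j /andP[ij]; rewrite -val_eqE /= => jE; lia.
  by rewrite big1 // => j ij; have := ltn_ord j; lia.
by rewrite -big_mkcond -(big_ord_widen n (fun=> 1%N) (leq_subr h n)) sum1_card card_ord.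
Qed.

(** Each of the four parity blocks of the matrix contributes the [n - h] entries of one
    superdiagonal, and [Q] selects blocks: the constant [true] takes all four, [addb] the two odd
    ones. *)
Lemma card_height (Q : bool -> bool -> bool) h : (0 < h)%N ->
  #|[pred x : I | (height x == h) && Q (idx_odd (val x).1) (idx_odd (val x).2)]|
    = ((Q false false + Q false true + Q true false + Q true true) * (n - h))%N.
Proof.
move=> h0; rewrite -sum1_card big_mkcond /=.
pose G (A B : 'I_(n + n)) : nat :=
  if (idx_pos B - idx_pos A == h)%N && Q (idx_odd A) (idx_odd B) then 1%N else 0%N.
rewrite -[LHS]/(\sum_(x : I) G (val x).1 (val x).2)%N sum_nil_basis.
have posl j : idx_pos (lshift n j) = j by rewrite /idx_pos (unsplitK (inl j)).
have posr j : idx_pos (rshift n j) = j by rewrite /idx_pos (unsplitK (inr j)).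
have oddl j : idx_odd (lshift n j) = false by rewrite /idx_odd (unsplitK (inl j)).
have oddr j : idx_odd (rshift n j) = true by rewrite /idx_odd (unsplitK (inr j)).
have block (q : bool) : (\sum_(i < n) \sum_(j < n | i < j)
    (if (j - i == h) && q then 1 else 0) = q * (n - h))%N.
  rewrite -(count_diagonal h0) big_distrr; apply: eq_bigr => i _.
  by rewrite big_distrr; apply: eq_bigr => j _; case: eqP; case: q.
rewrite big_split_ord /=; under eq_bigr do rewrite big_mkcond big_split_ord /=.
under [X in (_ + X)%N]eq_bigr do rewrite big_mkcond big_split_ord /=.
rewrite !big_split /= /G.
rewrite !mulnDl -!block addnA; congr (_ + _ + _ + _)%N;
  by apply: eq_bigr => i _; rewrite [RHS]big_mkcond; apply: eq_bigr => j _;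
     rewrite ?posl ?posr ?oddl ?oddr.
Qed.

End Counting.

Theorem mainTheorem7 (R : realType) (n : nat) (hn : (2 < n)%N) :
  (cohomology_dim (nil_superalgebra R[i] n) 2)%:Z
    = 8 * n%:Z ^+ 2 - 20 * n%:Z + 16.
Proof.
have C2 : 2%:R != 0 :> R[i] by rewrite Num.Theory.pnatr_eq0.
rewrite /cohomology_dim dim_nil_cocycles2 // dim_nil_coboundaries2.
pose S := [pred x : Defs.nil_basis n | height x == 1%N].
(* As half of the [4 * (n - 1)] height-1 elements are odd, the linear terms cancel and there are
   [8 * (n - 1) ^ 2] simple pairs. *)
have : (#|[pred p | @simple_pair n p]| * 2 + #|S|
        = #|S| ^ 2 + #|[pred x | S x && nil_par x]| * 2)%N.
  exact: card_skew_pairs.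
have -> : #|S| = (4 * (n - 1))%N.
  rewrite -(@card_height n (fun _ _ => true) 1) //.
  by apply: eq_card => x; rewrite !inE andbT.
have -> : #|[pred x | S x && nil_par x]| = (2 * (n - 1))%N.
  by rewrite -(@card_height n addb 1).
(* Splitting off height 2 exposes the count of height at least 3, which cancels against the same
   count for cocycles. *)
have -> : #|[pred x : Defs.nil_basis n | (1 < height x)%N]|
    = (4 * (n - 2) + #|[pred x : Defs.nil_basis n | (2 < height x)%N]|)%N.
  rewrite -(@card_height n (fun _ _ => true) 2) //.
  rewrite -(cardID [pred x | height x == 2]); congr (_ + _)%N;
    by apply: eq_card => x; rewrite !inE ?andbT; lia.
by rewrite expnS expn1; nia.
Qed.
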